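(* Let $R$ be a Dedekind domain with torsion class group, let $P$ be an almost cyclic prime ideal of $R$, and suppose that $U(R)$ is closed in the $P$-topology. Let $\Theta$ be the map $$\Theta\colon\mathcal{X}(P)\longrightarrow\mathcal{D}(P),\qquad X=\widetilde{\pi}_n^{-1}(L)\longmapsto[H_n(P):L],$$ where $X$ is written as $\widetilde{\pi}_n^{-1}(L)$ for some $n\geq 1$ and some subgroup $L$ of $H_n(P)$. Then the following hold. (a) $\Theta$ is well-defined (that is, every $X\in\mathcal{X}(P)$ is of the form $\widetilde{\pi}_n^{-1}(L)$ and the index $[H_n(P):L]$ depends only on $X$), injective and order-reversing. (b) If $R$ is Dirichlet at $P$, then $\Theta$ is surjective, and thus $\Theta$ is an order-reversing isomorphism.
   Context: A Dedekind domain is a one-dimensional Noetherian integrally closed domain; prime ideals $P$ considered here are nonzero; $U(R)$ is the group of units of $R$. The $P$-topology on $R\setminus P$ is the restriction of the $P$-adic topology, i.e., the topology generated by the cosets $a+P^n$ with $a\in R\setminus P$, $n\geq 1$. For $n\geq 1$, $\pi_n:R\to R/P^n$ is the canonical map, $H_n(P):=U(R/P^n)/\pi_n(U(R))$, and $\widetilde{\pi}_n:R\setminus P\to H_n(P)$ is the composition of $\pi_n$ (restricted to $R\setminus P\to U(R/P^n)$) with the quotient map $U(R/P^n)\to H_n(P)$. $P$ is almost cyclic if $R/P$ is finite and $H_n(P)$ is cyclic for every $n\geq 1$. For $a\in R\setminus P$, $\mathrm{pow}(a):=\{ua^t\mid u\in U(R),\ t\in\mathbb{N},\ t\geq 1\}$.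 An almost prime element of $R$ is an irreducible element generating a primary ideal. $\mathcal{X}(P)$ is the set of the closures, in the $P$-topology, of $\mathrm{pow}(q)$, as $q$ ranges among the almost prime elements of $R$ outside $P$; it is ordered by containment. $R$ is Dirichlet at $P$ if, for every $a\in R\setminus P$ and every $n\geq 1$, the coset $a+P^n$ contains at least one almost prime element. $\mathcal{D}(P):=\{d\in\mathbb{N}\mid d \text{ divides } |H_n(P)| \text{ for some } n\geq 1\}$, ordered by divisibility ($a\leq b$ iff $a\mid b$). *)

(* Defs.v *)
From HB Require Import structures.
From mathcomp Require Import all_boot all_algebra finmap.
From mathcomp Require Import generic_quotient ring_quotient fraction.
From mathcomp Require Import boolp classical_sets functions cardinality topology.

Set Implicit Arguments.
Unset Strict Implicit.
Unset Printing Implicit Defensive.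

Import GRing.Theory.

Local Open Scope ring_scope.
Local Open Scope quotient_scope.

(* A ^ n as additive span of the n-fold products of elements of A; this is the
   usual n-th power when n >= 1 and A is an ideal or a fractional ideal. *)
Definition idealX (T : pzRingType) (A : {pred T}) (n : nat) : {pred T} :=
  fun x => `[< exists2 s : seq (n.-tuple T),
    {in s, forall t : n.-tuple T, {subset t <= A}}
    & x = \sum_(t <- s) \prod_(y <- t) y >].

Definition principal (R : pzRingType) (q : R) : {pred R} :=
  fun x => `[< exists r, x = r * q >].

Section IdealPower.
Variables (R : comNzRingType) (I : idealr R).

Lemma idealX_idealr_closed n : idealr_closed (idealX I n.+1).
Proof.
split.
- by apply/asboolP; exists [::] => //; rewrite big_nil.
- apply/asboolPn => -[s sI e].
  have /negP := negbT (idealr1 I); apply; rewrite e.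
  elim: s sI {e} => [|t s IHs] sI; first by rewrite big_nil rpred0.
  rewrite big_cons rpredD //; last first.
    by apply: IHs => u us; apply: sI; rewrite inE us orbT.
  have := sI t; rewrite inE eqxx => /(_ isT); case/tupleP: t sI => y t sI tI.
  by rewrite big_cons mulrC idealMr // tI // inE eqxx.
- move=> a u v /asboolP[s sI ->] /asboolP[s' s'I ->]; apply/asboolP.
  pose f (t : n.+1.-tuple R) := [tuple of a * thead t :: behead t].
  exists ([seq f t | t <- s] ++ s').
    move=> t; rewrite mem_cat => /orP[/mapP[t0 t0s ->]|]; last exact: s'I.
    have := sI _ t0s; case/tupleP: t0 {t0s} => y t0 tI z.
    rewrite /= inE theadE => /orP[/eqP ->|zt].
      by rewrite idealMr // tI // inE eqxx.
    by apply: tI; rewrite inE zt orbT.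
  rewrite big_cat big_map mulr_sumr; congr (_ + _).
  apply: eq_bigr => t _; case/tupleP: t => y t.
  by rewrite /= !big_cons theadE mulrA.
Qed.

HB.instance Definition _ n :=
  isIdealr.Build R (idealX I n.+1) (idealX_idealr_closed n).

End IdealPower.

Section QuotientUnits.
Variables (R : comNzRingType) (I : idealr R).
Local Notation Q := {ideal_quot I}.

Definition quot_unit : pred Q := fun x => `[< exists y, y * x = 1 >].

Definition quot_inv (x : Q) : Q := xget x [set y | y * x = 1].

Lemma quot_mulVx : {in quot_unit, left_inverse 1 quot_inv *%R}.
Proof.
by move=> x /asboolP[y yx]; rewrite /quot_inv; case: xgetP => [//|/(_ y)].
Qed.

Lemma quot_unitPl (x y : Q) : y * x = 1 -> quot_unit x.
Proof. by move=> yx; apply/asboolP; exists y. Qed.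

Lemma quot_inv_out : {in [predC quot_unit], quot_inv =1 id}.
Proof.
move=> x /asboolPn nx; rewrite /quot_inv; case: xgetP => [y _ yx|//].
by case: nx; exists y.
Qed.

HB.instance Definition _ := GRing.ComNzRing_hasMulInverse.Build Q
  quot_mulVx quot_unitPl quot_inv_out.

End QuotientUnits.

Section UnitGroup.
Variable S : comUnitRingType.

(* The library's {unit S} requires S to be finite. *)
Definition unit_group : Type := {x : S | x \is a GRing.unit}.

HB.instance Definition _ := Choice.on unit_group.
HB.instance Definition _ := SubType.on unit_group.

Lemma unit_groupM (x y : unit_group) : val x * val y \is a GRing.unit.
Proof. by rewrite unitrM (valP x) (valP y). Qed.
Lemma unit_groupV (x : unit_group) : (val x)^-1 \is a GRing.unit.
Proof. by rewrite unitrV (valP x). Qed.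

Definition unit_mul (x y : unit_group) : unit_group :=
  exist _ (val x * val y) (unit_groupM x y).
Definition unit_one : unit_group := exist _ 1 (unitr1 S).
Definition unit_inv (x : unit_group) : unit_group := exist _ (val x)^-1 (unit_groupV x).

Lemma unit_mulA : associative unit_mul.
Proof. by move=> x y z; apply: val_inj; rewrite /= mulrA. Qed.
Lemma unit_mul1 : left_id unit_one unit_mul.
Proof. by move=> x; apply: val_inj; rewrite /= mul1r. Qed.
Lemma unit_1mul : right_id unit_one unit_mul.
Proof. by move=> x; apply: val_inj; rewrite /= mulr1. Qed.
Lemma unit_mulV : left_inverse unit_one unit_inv unit_mul.
Proof. by move=> x; apply: val_inj; rewrite /= mulVr // (valP x). Qed.
Lemma unit_Vmul : right_inverse unit_one unit_inv unit_mul.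
Proof. by move=> x; apply: val_inj; rewrite /= mulrV // (valP x). Qed.

HB.instance Definition _ := isGroup.Build unit_group
  unit_mulA unit_mul1 unit_1mul unit_mulV unit_Vmul.

Lemma unit_mulgC (x y : unit_group) : (x * y = y * x)%g.
Proof. by apply: val_inj; rewrite /= mulrC. Qed.

End UnitGroup.

Section ResidueGroup.
Variables (R : comUnitRingType) (I : idealr R).
Local Notation G := (unit_group {ideal_quot I}).

Definition unit_image : {pred G} :=
  fun x => `[< exists2 u : R, u \is a GRing.unit & val x = \pi u >].

Lemma unit_image_closed : group_closed unit_image.
Proof.
split; first by apply/asboolP; exists 1; rewrite ?unitr1 //= rmorph1.
move=> x y /asboolP[u uU xu] /asboolP[v vU yv]; apply/asboolP; exists (u / v).
  by rewrite unitrM uU unitrV.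
by rewrite /= xu yv rmorphM rmorphV.
Qed.

Definition res_equiv (x y : G) := (x / y)%g \in unit_image.

Lemma res_equiv_refl : reflexive res_equiv.
Proof. by move=> x; rewrite /res_equiv divgg (fst unit_image_closed). Qed.
Lemma res_equiv_sym : symmetric res_equiv.
Proof.
suff s x y : res_equiv x y -> res_equiv y x by move=> x y; apply/idP/idP => /s.
move=> /(group_closedV unit_image_closed).
by rewrite invgM invgK.
Qed.
Lemma res_equiv_trans : transitive res_equiv.
Proof.
move=> y x z xy yz.
have := group_closedM unit_image_closed xy yz.
by rewrite mulgA mulgVK.
Qed.

Canonical res_equiv_rel :=
  EquivRel res_equiv res_equiv_refl res_equiv_sym res_equiv_trans.

(* The group U(R/I) / \pi(U(R)). *)
Definition res_group : Type := {eq_quot res_equiv}.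

HB.instance Definition _ : EqQuotient G res_equiv res_group :=
  EqQuotient.on res_group.
HB.instance Definition _ := Choice.on res_group.

Definition res_one : res_group := lift_cst res_group (1%g : G).
Definition res_mul := lift_op2 res_group (fun x y : G => x * y)%g.
Definition res_inv := lift_op1 res_group (fun x : G => x^-1)%g.

Canonical pi_res_one_morph := PiConst res_one.

Lemma pi_res_inv : {morph \pi : x / x^-1%g >-> res_inv x}.
Proof.
move=> x; unlock res_inv; apply/eqmodP => /=.
have /eqmodP/= := reprK (\pi_res_group x).
by rewrite /res_equiv invgK unit_mulgC.
Qed.
Canonical pi_res_inv_morph := PiMorph1 pi_res_inv.

Lemma pi_res_mul : {morph \pi : x y / (x * y)%g >-> res_mul x y}.
Proof.
move=> x y; unlock res_mul; apply/eqmodP => /=.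
have xx : res_equiv x (repr (\pi_res_group x)) by apply/eqmodP; rewrite reprK.
have yy : res_equiv y (repr (\pi_res_group y)) by apply/eqmodP; rewrite reprK.
have := group_closedM unit_image_closed xx yy; rewrite /res_equiv.
by rewrite invgM -!mulgA [((repr _)^-1 * _)%g]unit_mulgC -!mulgA.
Qed.
Canonical pi_res_mul_morph := PiMorph2 pi_res_mul.

Lemma res_mulA : associative res_mul.
Proof.
by move=> x y z; rewrite -[x]reprK -[y]reprK -[z]reprK !piE mulgA.
Qed.
Lemma res_mulC : commutative res_mul.
Proof. by move=> x y; rewrite -[x]reprK -[y]reprK !piE unit_mulgC. Qed.
Lemma res_1mul : left_id res_one res_mul.
Proof. by move=> x; rewrite -[x]reprK !piE mul1g. Qed.
Lemma res_mul1 : right_id res_one res_mul.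
Proof. by move=> x; rewrite res_mulC res_1mul. Qed.
Lemma res_Vmul : left_inverse res_one res_inv res_mul.
Proof. by move=> x; rewrite -[x]reprK !piE mulVg. Qed.
Lemma res_mulV : right_inverse res_one res_inv res_mul.
Proof. by move=> x; rewrite res_mulC res_Vmul. Qed.

HB.instance Definition _ := isGroup.Build res_group
  res_mulA res_1mul res_mul1 res_Vmul res_mulV.

(* R -> R/I, landing in U(R/I), followed by U(R/I) -> U(R/I) / \pi(U(R)).
   If \pi x is not a unit then the value is 1; this never happens
   for x outside P when I is a power of the maximal ideal P. *)
Definition res_class (x : R) : res_group :=
  \pi_res_group (insubd (1%g : G) (\pi x)).

End ResidueGroup.

Section Groups.
Variable G : groupType.

Definition cyclic_group : Prop :=
  exists g : G, forall x, exists n, x = (g ^+ n)%g \/ x = (g ^- n)%g.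

(* Both cardinals are 0 when infinite. *)
Definition group_card : nat := #|` fset_set [set: G] |%fset.

Definition group_index (L : {pred G}) : nat :=
  #|` fset_set [set [set (x * y)%g | y in [set` L]] | x in [set: G]]%classic
  |%fset.

End Groups.

Section Dedekind.
Variable R : idomainType.
Local Notation K := {fraction R}.

(* The improper ideal, not an idealr, is generated by 1. *)
Definition noetherian : Prop := forall I : idealr R,
  exists s : seq R, forall x,
    x \in I <-> exists c : nat -> R, x = \sum_(i < size s) c i * s`_i.

Definition integrally_closed : Prop := forall x : K,
  integralOver (@tofrac R) x -> exists r : R, x = tofrac r.

Definition prime_chain (n : nat) (p : nat -> prime_idealr R) : Prop :=
  forall i, (i < n)%N ->
    {subset p i <= p i.+1} /\ ~ {subset p i.+1 <= p i}.

Definition one_dimensional : Prop :=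
  (exists p, prime_chain 1 p) /\ ~ (exists p, prime_chain 2 p).

Definition dedekind : Prop :=
  [/\ noetherian, integrally_closed & one_dimensional].

(* Nonzero fractional ideals, the elements of the ideal group. *)
Definition frac_ideal (J : {pred K}) : Prop :=
  [/\ exists2 x, x \in J & x != 0,
      forall (a : R) (x y : K), x \in J -> y \in J -> tofrac a * x + y \in J
    & exists2 d : R, d != 0 & forall x, x \in J -> exists r : R, tofrac d * x = tofrac r].

Definition principal_frac_ideal (J : {pred K}) : Prop :=
  exists2 c : K, c != 0 & forall x, x \in J <-> exists r : R, x = tofrac r * c.

Definition torsion_class_group : Prop := forall J, frac_ideal J ->
  exists n, principal_frac_ideal (idealX J n.+1).

Definition irreducible_elt (q : R) : Prop :=
  [/\ q != 0, q \isn't a GRing.unit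
    & forall a b, q = a * b -> a \is a GRing.unit \/ b \is a GRing.unit].

Definition primary_ideal (I : {pred R}) : Prop :=
  idealr_closed I /\
  forall a b, a * b \in I -> a \in I \/ exists n, b ^+ n.+1 \in I.

Definition almost_prime (q : R) : Prop :=
  irreducible_elt q /\ primary_ideal (principal q).

End Dedekind.

Local Open Scope classical_set_scope.

Section PTopology.
Variables (R : idomainType) (P : prime_idealr R).

Definition outside : Type := {x : R | x \notin P}.

HB.instance Definition _ := SubType.on outside.
HB.instance Definition _ := Choice.on outside.

Definition P_cosets : set (set outside) :=
  [set A | exists (a : outside) (n : nat),
    A = [set x | val x - val a \in idealX P n.+1]].

HB.instance Definition _ := isSubBaseTopological.Build outside P_cosets id.

Definition units_outside : set outside :=
  [set x | val x \is a GRing.unit].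

(* The group H_(n+1)(P): the index is shifted, as n >= 1 throughout. *)
Definition Hgrp (n : nat) : groupType := res_group (idealX P n.+1).

Definition pi_tilde (n : nat) (x : outside) : Hgrp n :=
  res_class (idealX P n.+1) (val x).

Definition almost_cyclic : Prop :=
  finite_set [set: {ideal_quot P}] /\ forall n, cyclic_group (Hgrp n).

Definition pow_set (a : outside) : set outside :=
  [set x | exists (u : R) (t : nat),
    [/\ u \is a GRing.unit, (0 < t)%N & val x = u * val a ^+ t]].

Definition calX : set (set outside) :=
  [set closure (pow_set q) | q in [set q : outside | almost_prime (val q)]].

Definition calD : set nat :=
  [set d | exists n, (d %| group_card (Hgrp n))%N].

Definition dirichlet : Prop := forall (a : outside) (n : nat),
  exists q : R, almost_prime q /\ q - val a \in idealX P n.+1.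

Definition preim_tilde (n : nat) (L : {pred Hgrp n}) : set outside :=
  [set x | pi_tilde n x \in L].

Definition Theta (X : set outside) : nat :=
  xget 0%N [set d | exists (n : nat) (L : {pred Hgrp n}),
    [/\ group_closed L, X = preim_tilde L & d = group_index L]].

End PTopology.

Arguments units_outside {R} P.
Arguments calX {R} P.
Arguments calD {R} P.
Arguments Theta {R} P X.
Arguments Hgrp {R} P n.

(* Main.v *)
Require Import Defs.
From mathcomp Require Import all_boot all_algebra finmap.
From mathcomp Require Import generic_quotient ring_quotient boolp.
From mathcomp Require Import classical_sets functions cardinality topology.

(** Write H_n for U(R/P^n) / U(R), which is the group Hgrp P n.-1, and let P be
    almost cyclic.  A generator of H_N is the class of some x outside P, and x
    then generates H_n for every n <= N.  Hence, if X is the preimage of a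
    subgroup L of H_n with n <= N, then an element y outside P with class x^i in
    H_N lies in X exactly when the index [H_n : L] divides i
    ([preim_of_index_coords]).  So the index determines X, and X is contained in
    Y exactly when the index of Y divides the index of X
    ([preim_of_index_sub]).  Theta is therefore well defined, injective and
    order-reversing as soon as all the members of X(P) are such preimages.

    An element y is in the closure of pow(q) when, for all n, its class in H_n
    is a power of the class of q ([closure_powP]).  This infinite list of
    conditions reduces to a single one for the following reason.  The residue
    field is finite, of some characteristic p, and raising to the power p maps
    1 + P^n into 1 + P^(n+1) ([expr_near1]), so the orders of the cyclic groups
    H_n are m * p^(a_n) with m independent of n ([card_Hgrp_shape]).  If the
    class of q^m in H_n is not trivial, then the index of the subgroup generated
    by q is the same in H_n and in all H_N with N >= n, and the condition at n
    implies all others ([closure_pow_stable]).  Such an n exists when q is an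
    almost prime: q is not a unit, so q^m is not a unit either, and U(R) is
    closed ([nonunit_cls]).

    The same argument shows that the orders of the H_n are unbounded if there is
    a nonunit outside P.  When R is Dirichlet at P there is one, and a divisor d
    of the order of H_n is then attained as follows: for N large enough, x
    generating H_N, the class of x^(d * m) is not trivial in H_N, and the
    closure of pow(q) has index d for every almost prime q with the class of x^d
    in H_N ([dirichlet_preim_of_index]). *)

Set Implicit Arguments.
Unset Strict Implicit.
Unset Printing Implicit Defensive.

Import GRing.Theory.

(** * Arithmetic of orders *)

(** The gcd divides m * gcdn j (p ^ b) = m * p ^ c, and c <= a because otherwise
    p ^ a divides j.  When j is the exponent of an element h in cyclic groups of
    orders m * p ^ a and m * p ^ b, its gcds with these orders are the indices of
    the subgroups generated by h, and the hypothesis says that h ^ m is not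
    trivial in the first group. *)
Lemma gcdn_stable p m a b j : prime p ->
  ~~ (m * p ^ a %| j * m)%N -> (gcdn j (m * p ^ b) %| m * p ^ a)%N.
Proof.
move=> p_pr npj.
have [c _ jc] : exists2 c, (c <= b)%N & gcdn j (p ^ b) = (p ^ c)%N.
  by apply/dvdn_pfactor; rewrite ?dvdn_gcdr.
have ca : (c <= a)%N.
  rewrite leqNgt; apply: contra npj => /ltnW ac; rewrite mulnC dvdn_mul //.
  by apply: dvdn_trans (dvdn_exp2l p ac) _; rewrite -jc dvdn_gcdl.
apply: (@dvdn_trans (m * p ^ c)%N); last by rewrite dvdn_mul // dvdn_exp2l.
by rewrite -jc muln_gcdr dvdn_gcd dvdn_gcdr (dvdn_trans (dvdn_gcdl _ _)) // dvdn_mull.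
Qed.

(** Passing from m to n can only change the p-part. *)
Lemma partn_prime_bound p m n k : prime p -> (0 < m)%N -> (m %| n)%N ->
  (n %| m * p ^ k)%N -> exists a, n = (m`_p^' * p ^ a)%N.
Proof.
move=> p_pr m0 mn nmp.
have pk0 : (0 < p ^ k)%N by rewrite expn_gt0 prime_gt0.
have n0 : (0 < n)%N by apply: (dvdn_gt0 _ nmp); rewrite muln_gt0 m0.
exists (logn p n); rewrite -p_part mulnC -{1}(partnC p n0); congr (_ * _)%N.
apply/eqP; rewrite eqn_dvd; apply/andP; split; last exact: partn_dvd.
have := @partn_dvd (p^')%N n _ (_ : 0 < m * p ^ k)%N nmp.
rewrite muln_gt0 m0 pk0 partnM // (part_p'nat (_ : ((p^')%N^')%N.-nat (p ^ k)%N)).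
  by rewrite muln1; apply.
by rewrite pnatNK pnatX pnat_id.
Qed.

(** * Groups generated by the powers of a torsion element *)

Local Open Scope classical_set_scope.

Lemma card_periodic_range (T : choiceType) (f : nat -> T) d : (0 < d)%N ->
  (forall i j, f i = f j <-> i = j %[mod d]) ->
  #|` fset_set (range f)|%fset = d.
Proof.
move=> d0 fE; apply: card_fset_set.
have -> : range f = [set f i | i in `I_d].
  rewrite eqEsubset; split=> _ [i _ <-]; last by exists i.
  exists (i %% d)%N; first by rewrite /= ltn_mod.
  by apply/fE; rewrite modn_mod.
apply: inj_card_eq => i j; rewrite !inE /= => id jd /fE.
by rewrite !modn_small.
Qed.

Section PowerGenerated.
Local Open Scope group_scope.
Variables (G : groupType) (g : G).
Hypothesis gen_g : forall x, exists i, x = g ^+ i.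
Hypothesis tor_g : exists2 m, (0 < m)%N & g ^+ m = 1.

(** The exponent d is the least positive one that sends g into L. *)
Lemma subgroup_exponents (L : {pred G}) : group_closed L ->
  exists2 d, (0 < d)%N & forall i, (g ^+ i \in L) = (d %| i)%N.
Proof.
move=> Lgrp; have [L1 _] := Lgrp.
have LM := group_closedM Lgrp; have LV := group_closedV Lgrp.
have LX x i : x \in L -> x ^+ i \in L.
  by move=> xL; elim: i => [|i IH]; rewrite ?expg0 // expgS LM.
have exL : exists i, (0 < i)%N && (g ^+ i \in L).
  by have [m m0 gm] := tor_g; exists m; rewrite m0 gm.
case: (ex_minnP exL) => d /andP[d0 gd] dmin; exists d => // i.
apply/idP/idP => [gi|/dvdnP[k ->]]; last by rewrite mulnC expgnA LX.
rewrite /dvdn; apply: contraT; rewrite -lt0n => i0.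
have : (d <= i %% d)%N.
  apply: dmin; rewrite i0 /= -(mulKg (g ^+ (i %/ d * d)) (g ^+ _)) -expgnDr.
  by rewrite -divn_eq LM // LV // mulnC expgnA LX.
by rewrite leqNgt ltn_mod d0.
Qed.

(** The cosets of L are those of the g ^+ i, which depend on i modulo d only. *)
Lemma power_subgroup (L : {pred G}) : group_closed L ->
  (0 < group_index L)%N /\ forall i, (g ^+ i \in L) = (group_index L %| i)%N.
Proof.
move=> Lgrp; have [L1 _] := Lgrp.
have LM := group_closedM Lgrp; have LV := group_closedV Lgrp.
have [d d0 memL] := subgroup_exponents Lgrp.
suff -> : group_index L = d by [].
pose coset x : set G := [set x * y | y in [set` L]].
have cosetE x z : coset x = coset z <-> x^-1 * z \in L.
  split=> [e|xzL].
    have [y /= yL <-] : coset x z by rewrite e; exists 1; rewrite ?mulg1.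
    by rewrite mulKg.
  rewrite eqEsubset; split=> _ [y /= yL <-].
    exists ((x^-1 * z)^-1 * y); first by rewrite /= LM // LV.
    by rewrite invgM invgK !mulgA mulgV mul1g.
  exists (x^-1 * z * y); first exact: LM.
  by rewrite !mulgA mulgV mul1g.
rewrite /group_index -/coset.
have -> : [set coset x | x in [set: G]] = range (fun i => coset (g ^+ i)).
  rewrite eqEsubset; split=> _ [x _ <-]; last by exists (g ^+ x).
  by have [i ->] := gen_g x; exists i.
apply: card_periodic_range => // i j.
wlog ij : i j / (i <= j)%N.
  move=> W; case: (leqP i j) => [|/ltnW] /W // [ji ij].
  by split=> [/esym/ji|/esym/ij].
rewrite cosetE -{1}(subnKC ij) expgnDr mulKg memL -eqn_mod_dvd //.
by split=> [/eqP|->].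
Qed.

Lemma power_eq_mod d : (forall i, (g ^+ i == 1) = (d %| i)%N) ->
  forall i j, (g ^+ i == g ^+ j) = (i == j %[mod d])%N.
Proof.
move=> gE i j; wlog ij : i j / (i <= j)%N.
  by move=> W; case: (leqP i j) => [|/ltnW] /W //; rewrite eq_sym => ->; rewrite eq_sym.
rewrite [RHS]eq_sym eqn_mod_dvd // -gE -{1}(subnKC ij) expgnDr.
by rewrite -{1}[g ^+ i]mulg1 eq_sym (inj_eq (mulgI _)).
Qed.

Lemma power_order :
  (0 < group_card G)%N /\ forall i, (g ^+ i == 1) = (group_card G %| i)%N.
Proof.
have triv : group_closed (pred1 (1 : G)).
  split; first by rewrite inE.
  by move=> x y; rewrite !inE => /eqP-> /eqP->; rewrite divgg.
have [d d0 memd] := subgroup_exponents triv.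
have gE i : (g ^+ i == 1) = (d %| i)%N by rewrite -memd.
suff -> : group_card G = d by [].
have -> : group_card G = #|` fset_set (range (fun i => g ^+ i))|%fset.
  congr #|` fset_set _|%fset; rewrite eqEsubset; split=> x // _.
  by have [i ->] := gen_g x; exists i.
apply: card_periodic_range => // i j.
by split=> /eqP e; apply/eqP; move: e; rewrite (power_eq_mod gE).
Qed.

Definition powers (h : G) : {pred G} := fun x => `[< exists t, x = h ^+ t >].

Lemma powersP h x : reflect (exists t, x = h ^+ t) (x \in powers h).
Proof. exact: asboolP. Qed.

Lemma powers_closed h : group_closed (powers h).
Proof.
have [M0 gE] := power_order.
have hM : h ^+ group_card G = 1.
  have [j ->] := gen_g h; apply/eqP.
  by rewrite -expgnA gE dvdn_mull.
split; first by apply/powersP; exists 0%N; rewrite expg0.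
move=> _ _ /powersP[t ->] /powersP[s ->]; apply/powersP.
(* s * (|G| - 1) is a natural exponent for h ^- s *)
exists (t + s * (group_card G).-1)%N; rewrite expgnDr; congr (_ * _).
apply: (mulgI (h ^+ s)); rewrite mulgV -expgnDr -mulnS prednK //.
by rewrite mulnC expgnA hM expg1n.
Qed.

Lemma powers_index j : group_index (powers (g ^+ j)) = gcdn j (group_card G).
Proof.
have [d0 memL] := power_subgroup (powers_closed (g ^+ j)).
have [M0 gE] := power_order; set d := group_index _ in d0 memL *.
have dj : (d %| j)%N by rewrite -memL; apply/powersP; exists 1%N.
have dM : (d %| group_card G)%N.
  by rewrite -memL (eqP (_ : g ^+ _ == 1)) ?gE //; case: (powers_closed (g ^+ j)).
apply/eqP; rewrite eqn_dvd dvdn_gcd dj dM /=.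
have /powersP[t /eqP] : g ^+ d \in powers (g ^+ j) by rewrite memL.
rewrite -expgnA (power_eq_mod gE) => /eqP e.
rewrite /dvdn -(modn_dvdm d (dvdn_gcdr j _)) e (modn_dvdm _ (dvdn_gcdr _ _)).
by rewrite -/(dvdn _ _) dvdn_mulr ?dvdn_gcdl.
Qed.

Lemma mem_powers i j : (g ^+ i \in powers (g ^+ j)) = (gcdn j (group_card G) %| i)%N.
Proof. by have [_ ->] := power_subgroup (powers_closed (g ^+ j)); rewrite powers_index. Qed.

End PowerGenerated.

(** * Powers of a prime ideal *)

Section IdealPowers.
Local Open Scope ring_scope.
Local Open Scope quotient_scope.
Variables (R : idomainType) (P : prime_idealr R).

Lemma prime_idealrX x i : x \notin P -> x ^+ i \notin P.
Proof.
move=> xP; elim: i => [|i IH]; first by rewrite expr0 idealr1.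
by rewrite exprS prime_idealrM negb_or xP.
Qed.

Lemma unit_notin_prime u : u \is a GRing.unit -> u \notin P.
Proof.
move=> uU; apply/negP => uP.
by have := idealMr u^-1 uP; rewrite mulVr // idealr1.
Qed.

Lemma idealXS n x y : x \in P -> y \in idealX P n -> x * y \in idealX P n.+1.
Proof.
move=> xP /asboolP[s sP ->]; apply/asboolP.
exists [seq cons_tuple x t | t : n.-tuple R <- s].
  move=> _ /mapP[t ts ->] z; rewrite inE => /predU1P[->//|]; exact: sP.
rewrite big_map mulr_sumr; apply: eq_bigr => t _.
by rewrite big_cons.
Qed.

Lemma idealXW n : {subset idealX P n.+2 <= idealX P n.+1}.
Proof.
move=> _ /asboolP[s sP ->]; rewrite big_seq; apply: rpred_sum => t ts.
case/tupleP: t ts => x t /sP tP; rewrite big_cons idealMr //.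
apply/asboolP; exists [:: t]; last by rewrite big_seq1.
by move=> _ /predU1P[->|//] z zt; apply: tP; rewrite inE zt orbT.
Qed.

Lemma idealX_leq m n : (m <= n)%N -> {subset idealX P n.+1 <= idealX P m.+1}.
Proof.
move=> /subnKC <-; elim: (n - m)%N => [|k IH] x; first by rewrite addn0.
by rewrite addnS => /idealXW /IH.
Qed.

Lemma idealX1 : idealX P 1 =i P.
Proof.
move=> x; apply/idP/idP => [/asboolP[s sP ->]|xP].
  rewrite big_seq; apply: rpred_sum => t ts.
  case/tupleP: t ts => y t /sP tP; rewrite big_cons mulrC idealMr //.
  by apply: tP; rewrite inE eqxx.
apply/asboolP; exists [:: [tuple x]]; last by rewrite !big_seq1.
by move=> _ /predU1P[->|//] z; rewrite inE => /eqP ->.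
Qed.

Lemma idealX_sub n : {subset idealX P n.+1 <= P}.
Proof. by move=> x /(idealX_leq (leq0n n)); rewrite idealX1. Qed.

(** In x ^+ p - 1 = (x - 1) * \sum_(i < p) x ^+ i, the sum is congruent to p
    modulo P, hence it contributes one more factor in P. *)
Lemma expr_near1 p n (x : R) : p%:R \in P ->
  x - 1 \in idealX P n.+1 -> x ^+ p - 1 \in idealX P n.+2.
Proof.
move=> pP x1; rewrite subrX1 mulrC idealXS //.
have -> : \sum_(i < p) x ^+ i = \sum_(i < p) (x ^+ i - 1) + p%:R.
  by rewrite sumrB sumr_const card_ord subrK.
rewrite rpredD // rpred_sum // => i _.
by rewrite subrX1 mulrC idealMr // (idealX_sub x1).
Qed.

Lemma exprX_near1 p n (x : R) : p%:R \in P ->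
  x - 1 \in P -> x ^+ (p ^ n) - 1 \in idealX P n.+1.
Proof.
move=> pP x1; elim: n => [|n IH]; first by rewrite idealX1.
by rewrite expnSr exprM expr_near1.
Qed.

Section FiniteResidueRing.
Hypothesis finRP : finite_set [set: {ideal_quot P}].

Lemma residue_repeat (f : nat -> R) : exists i j, (i < j)%N /\ f j - f i \in P.
Proof.
apply: contrapT => nex; apply: infinite_nat.
pose F (i : nat) := \pi_({ideal_quot P}) (f i).
have Finj : {in [set: nat] &, injective F}.
  move=> i j _ _ /eqP; rewrite -Quotient.idealrBE => e.
  apply/eqP; apply: contraT; rewrite neq_ltn => /orP[] ij; case: nex.
    by exists i, j; rewrite ij -opprB rpredN.
  by exists j, i.
exact: sub_finite_set (finite_preimage Finj finRP).
Qed.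

(** Two distinct integers are congruent modulo P; a prime factor of their
    difference is in P. *)
Lemma residue_char : exists2 p, prime p & p%:R \in P.
Proof.
have [i [j [ij]]] := residue_repeat (fun i => i%:R).
rewrite -natrB 1?ltnW // => dP.
have : (0 < j - i)%N by rewrite subn_gt0.
elim/ltn_ind: (j - i)%N dP => {i j ij} d IH dP d0.
case: (ltnP 1 d) => d1; last first.
  have d_1 : d = 1%N by apply/eqP; rewrite eqn_leq d1.
  by move: dP; rewrite d_1 idealr1.
move: dP; rewrite -{1}(divnK (pdiv_dvd d)) natrM prime_idealrM => /orP[dP|pP].
  apply: (IH (d %/ pdiv d)%N); rewrite ?ltn_Pdiv ?prime_gt1 ?pdiv_prime //.
  by rewrite divn_gt0 ?pdiv_leq ?pdiv_gt0.
by exists (pdiv d) => //; apply: pdiv_prime.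
Qed.

(** Two powers of x are congruent modulo P, and x can be cancelled. *)
Lemma residue_exp x : x \notin P -> exists2 m, (0 < m)%N & x ^+ m - 1 \in P.
Proof.
move=> xP; have [i [j [ij]]] := residue_repeat (fun i => x ^+ i).
rewrite -(subnKC (ltnW ij)) exprD -{2}[x ^+ i]mulr1 -mulrBr prime_idealrM.
by rewrite (negPf (prime_idealrX i xP)) /=; exists (j - i)%N; rewrite ?subn_gt0.
Qed.

(** * Classes of elements modulo units *)

Local Notation Q n := {ideal_quot (idealX P n.+1)}.
Local Notation cls n x := (res_class (idealX P n.+1) x).

Lemma pi_eqP n x y : \pi_(Q n) x = \pi_(Q n) y <-> x - y \in idealX P n.+1.
Proof. by rewrite Quotient.idealrBE; split=> /eqP. Qed.

(** If x ^+ m is in 1 + P, then x ^+ (m * p ^ n) is in 1 + P^(n+1), so that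
    a power of x is an inverse of x modulo P^(n+1). *)
Lemma pi_unit n x : x \notin P -> \pi_(Q n) x \is a GRing.unit.
Proof.
have [p p_pr pP] := residue_char; move=> /residue_exp[m m0 xm].
have k0 : (0 < m * p ^ n)%N by rewrite muln_gt0 m0 expn_gt0 prime_gt0.
have /pi_eqP e : x ^+ (m * p ^ n) - 1 \in idealX P n.+1.
  by rewrite exprM exprX_near1.
have xk : (\pi_(Q n) x) ^+ (m * p ^ n) = 1
  by rewrite -rmorphXn; exact: (etrans e (rmorph1 _)).
by rewrite -(unitrX_pos _ k0) xk unitr1.
Qed.

Lemma val_pi_unit n x : x \notin P ->
  val (insubd (1%g : unit_group (Q n)) (\pi x)) = \pi_(Q n) x.
Proof. by move=> xP; rewrite insubdK //; apply: pi_unit. Qed.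

Lemma cls_eqP n x y : x \notin P -> y \notin P ->
  cls n x = cls n y <-> exists2 u, u \is a GRing.unit & x - u * y \in idealX P n.+1.
Proof.
move=> xP yP; have yU := pi_unit n yP.
have E u : (x - u * y \in idealX P n.+1) <-> \pi_(Q n) x / \pi_(Q n) y = \pi_(Q n) u.
  have uyE : \pi_(Q n) (u * y) = \pi_(Q n) u * \pi_(Q n) y := rmorphM _ u y.
  rewrite -pi_eqP uyE; split=> [->|<-]; first by rewrite mulrK.
  by rewrite divrK.
split=> [/eqmodP/asboolP[u uU]|[u uU /E e]].
  by rewrite /= !val_pi_unit // => /E; exists u.
by apply/eqmodP/asboolP; exists u; rewrite //= !val_pi_unit.
Qed.

Lemma cls_near n x y : x - y \in idealX P n.+1 -> cls n x = cls n y.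
Proof. by move=> /pi_eqP e; rewrite /res_class e. Qed.

Lemma clsM n x y : x \notin P -> y \notin P -> cls n (x * y) = (cls n x * cls n y)%g.
Proof.
move=> xP yP; have xyP : x * y \notin P by rewrite prime_idealrM negb_or xP.
rewrite /res_class [RHS](esym (pi_res_mul _ _)); congr (\pi _).
by apply: val_inj; rewrite /= !val_pi_unit //; exact: (rmorphM _ x y).
Qed.

Lemma cls1 n : cls n 1 = 1%g.
Proof.
rewrite /res_class [RHS]piE; congr (\pi _).
by apply: val_inj; rewrite /= val_pi_unit ?idealr1 //; exact: (rmorph1 _).
Qed.

Lemma cls_eq1P n x : x \notin P ->
  cls n x = 1%g <-> exists2 u, u \is a GRing.unit & x - u \in idealX P n.+1.
Proof.
move=> xP; rewrite -(cls1 n) cls_eqP ?idealr1 //.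
by split=> -[u uU xu]; exists u; rewrite ?mulr1 // in xu *.
Qed.

Lemma clsX n x i : x \notin P -> cls n (x ^+ i) = (cls n x ^+ i)%g.
Proof.
move=> xP; elim: i => [|i IH]; first by rewrite expr0 cls1.
by rewrite exprS clsM ?prime_idealrX // IH expgS.
Qed.

Lemma cls_surj n (h : Hgrp P n) : exists2 x, x \notin P & h = cls n x.
Proof.
have [z zh] : exists z : unit_group (Q n), h = \pi z by exists (repr h); rewrite reprK.
have [x xz] : exists x, val z = \pi_(Q n) x by exists (repr (val z)); rewrite reprK.
exists x; last by rewrite zh /res_class -xz valKd.
apply/negP => xP.
have /unitrP[w [wx _]] := valP z.
have : \pi_(Q n) (repr w * x) = \pi_(Q n) 1.
  by rewrite -[RHS](esym (rmorph1 _)) -wx xz -{2}[w]reprK; exact: rmorphM.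
by move=> /pi_eqP/idealX_sub; rewrite rpredBl ?idealMr ?idealr1.
Qed.

Lemma cls_leq m n x y : (m <= n)%N -> x \notin P -> y \notin P ->
  cls n x = cls n y -> cls m x = cls m y.
Proof.
move=> mn xP yP /cls_eqP[]// u uU /(idealX_leq mn) xuy.
by apply/cls_eqP => //; exists u.
Qed.

End FiniteResidueRing.
End IdealPowers.

(** * The orders of the groups H_n *)

Section AlmostCyclic.
Local Open Scope ring_scope.
Local Open Scope quotient_scope.
Variables (R : idomainType) (P : prime_idealr R).
Hypothesis hP : almost_cyclic P.
Let finRP : finite_set [set: {ideal_quot P}] := hP.1.
Local Notation cls n x := (res_class (idealX P n.+1) x).

(** The finiteness of H_n, which is cyclic, comes from here: x ^+ m is in 1 + P
    for some m > 0, and then x ^+ (m * p ^ n) is in 1 + P^(n+1). *)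
Lemma Hgrp_torsion n (h : Hgrp P n) : exists2 m, (0 < m)%N & (h ^+ m)%g = 1%g.
Proof.
have [x xP ->] := cls_surj h.
have [p p_pr pP] := residue_char finRP; have [m m0 xm] := residue_exp finRP xP.
exists (m * p ^ n)%N; first by rewrite muln_gt0 m0 expn_gt0 prime_gt0.
rewrite -clsX // -(cls1 finRP); apply: cls_near.
by rewrite exprM exprX_near1.
Qed.

(** All levels up to n share a generator, because a relation between classes at
    level n persists at lower levels. *)
Lemma Hgrp_generator n : exists2 x, x \notin P &
  forall m, (m <= n)%N -> forall h : Hgrp P m, exists i, h = (cls m x ^+ i)%g.
Proof.
have [g gen_g] := hP.2 n; have [x xP gx] := cls_surj g.
have gen h : exists i, h = (g ^+ i)%g.
  have [m m0 gm] := Hgrp_torsion g.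
  have [i [->|->]] := gen_g h; first by exists i.
  exists (i * m.-1)%N; apply: (mulgI (g ^+ i)%g).
  by rewrite mulgV -expgnDr -mulnS prednK // mulnC expgnA gm expg1n.
exists x => // m mn h; have [y yP ->] := cls_surj h.
have [i yi] := gen (cls n y); exists i.
rewrite -clsX //; apply: (cls_leq finRP mn) => //; first exact: prime_idealrX.
by rewrite yi gx clsX.
Qed.

Lemma card_Hgrp_gt0 n : (0 < group_card (Hgrp P n))%N.
Proof.
have [x xP /(_ n (leqnn n)) gen] := Hgrp_generator n.
by have [] := power_order gen (Hgrp_torsion _).
Qed.

Lemma Hgrp_expgE n x : x \notin P ->
  (forall h : Hgrp P n, exists i, h = (cls n x ^+ i)%g) ->
  forall i, ((cls n x ^+ i)%g == 1%g) = (group_card (Hgrp P n) %| i)%N.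
Proof. by move=> xP gen; have [] := power_order gen (Hgrp_torsion _). Qed.

Lemma Hgrp_expg_card n (h : Hgrp P n) : (h ^+ group_card (Hgrp P n))%g = 1%g.
Proof.
have [x xP /(_ n (leqnn n)) gen] := Hgrp_generator n.
have [i ->] := gen h; apply/eqP.
by rewrite -expgnA Hgrp_expgE // dvdn_mull.
Qed.

Lemma card_Hgrp_dvd m n : (m <= n)%N ->
  (group_card (Hgrp P m) %| group_card (Hgrp P n))%N.
Proof.
move=> mn; have [x xP gen] := Hgrp_generator n.
rewrite -(Hgrp_expgE xP (gen m mn)) -clsX // -(cls1 finRP); apply/eqP.
apply: (cls_leq finRP mn); rewrite ?prime_idealrX ?idealr1 //.
by rewrite clsX // Hgrp_expg_card cls1.
Qed.

(** If x ^+ M, with M the order at level 0, is congruent modulo P to a unit u,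
    then (x ^+ M / u) ^+ (p ^ n) is in 1 + P^(n+1). *)
Lemma card_Hgrp_bound p n : p%:R \in P ->
  (group_card (Hgrp P n) %| group_card (Hgrp P 0) * p ^ n)%N.
Proof.
move=> pP; have [x xP gen] := Hgrp_generator n.
rewrite -(Hgrp_expgE xP (gen n (leqnn n))) -clsX //; apply/eqP.
have : cls 0 (x ^+ group_card (Hgrp P 0)) = 1%g by rewrite clsX // Hgrp_expg_card.
move=> /cls_eq1P[]//; rewrite ?prime_idealrX // => u uU.
rewrite idealX1 => xu; apply/cls_eq1P; rewrite ?prime_idealrX //.
exists (u ^+ (p ^ n)); first exact: unitrX.
have : (x ^+ group_card (Hgrp P 0) / u) ^+ (p ^ n) - 1 \in idealX P n.+1.
  by rewrite exprX_near1 // -(divrr uU) -mulrBl mulrC idealMr.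
move=> /(idealMr (u ^+ (p ^ n))).
by rewrite mulrBr mulr1 -exprMn mulrC divrK // exprM.
Qed.

Lemma card_Hgrp_shape : exists p m, [/\ prime p, (0 < m)%N &
  forall n, exists a, group_card (Hgrp P n) = (m * p ^ a)%N].
Proof.
have [p p_pr pP] := residue_char finRP.
exists p, ((group_card (Hgrp P 0))`_p^')%N; split=> // n.
apply: (partn_prime_bound p_pr (card_Hgrp_gt0 0)).
  exact: card_Hgrp_dvd.
exact: card_Hgrp_bound.
Qed.

End AlmostCyclic.

(** * Neighbourhoods and closures for the P-topology *)

Section Topology.
Local Open Scope ring_scope.
Local Open Scope quotient_scope.
Variables (R : idomainType) (P : prime_idealr R).

Lemma open_coset (a : outside P) n :
  open [set x : outside P | val x - val a \in idealX P n.+1].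
Proof.
set A := [set x | _].
exists [set A]; last by rewrite bigcup_set1.
move=> _ ->; exists [fset A]%fset.
  by move=> B /fset1P ->; rewrite inE; exists a, n.
by rewrite set_fset1 bigcap_set1.
Qed.

(** The cosets are given as a subbase only; they form a basis of neighbourhoods
    because a coset contains the cosets of smaller ideals of all its points. *)
Lemma nbhs_outsideP (a : outside P) (B : set (outside P)) : nbhs a B <->
  exists n, [set x : outside P | val x - val a \in idealX P n.+1] `<=` B.
Proof.
split=> [|[n sB]]; last first.
  apply: filterS sB _; apply: open_nbhs_nbhs; split; first exact: open_coset.
  by rewrite /= subrr rpred0.
rewrite nbhsE => -[U [[D' D'sub <-] [V D'V Va]] UB].
have [E Esub VE] := D'sub V D'V.
suff [n sn] : exists n, forall A, A \in enum_fset E ->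
    [set x : outside P | val x - val a \in idealX P n.+1] `<=` A.
  exists n => x xn; have Vx : V x by rewrite -VE => A AE; apply: (sn A).
  by apply: UB; exists V.
have aE A : A \in enum_fset E -> A a /\ P_cosets A.
  move=> AE; split; first by move: Va; rewrite -VE; apply.
  by have := Esub A AE; rewrite inE.
elim: (enum_fset E) aE => [|A s IH] aE; first by exists 0%N.
have [|n sn] := IH; first by move=> B' B's; apply: aE; rewrite inE B's orbT.
have [Aa [b [m AE]]] := aE A (mem_head _ _).
exists (maxn n m) => B'; rewrite inE => /predU1P[->|/sn sB'] x /= xn; last first.
  by apply: sB'; apply: idealX_leq xn; rewrite leq_maxl.
move: Aa; rewrite AE /= => ab; rewrite -(subrK (val a) (val x)) -addrA rpredD //.
by apply: idealX_leq xn; rewrite leq_maxr.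
Qed.

Lemma closure_outsideP (A : set (outside P)) (x : outside P) : closure A x <->
  forall n, exists2 y, A y & val y - val x \in idealX P n.+1.
Proof.
split=> [clA n|clA B /nbhs_outsideP[n sB]].
  have [|y [Ay yx]] := clA [set y | val y - val x \in idealX P n.+1].
    by apply/nbhs_outsideP; exists n.
  by exists y.
by have [y Ay yx] := clA n; exists y; split => //; apply: sB.
Qed.

End Topology.

(** * Preimages of subgroups of the groups H_n *)

Section Preimages.
Local Open Scope ring_scope.
Local Open Scope quotient_scope.
Variables (R : idomainType) (P : prime_idealr R).
Hypothesis hP : almost_cyclic P.
Let finRP : finite_set [set: {ideal_quot P}] := hP.1.
Local Notation cls n x := (res_class (idealX P n.+1) x).

Definition preim_of_index (X : set (outside P)) d := exists n (L : {pred Hgrp P n}),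
  [/\ group_closed L, X = preim_tilde L & d = group_index L].

(** The exponent i of x is a common coordinate for X and Y: x generates the
    groups of both levels. *)
Lemma preim_of_index_coords X Y d e : preim_of_index X d -> preim_of_index Y e ->
  exists x : outside P,
    (forall i (y : outside P), val y = val x ^+ i ->
       (X y <-> (d %| i)%N) /\ (Y y <-> (e %| i)%N)) /\
    (forall y, exists i, (X y <-> (d %| i)%N) /\ (Y y <-> (e %| i)%N)).
Proof.
move=> [m [L [Lgrp -> ->]]] [n [M [Mgrp -> ->]]].
have [x xP gen] := Hgrp_generator hP (maxn m n).
have genm := gen m (leq_maxl _ _); have genn := gen n (leq_maxr _ _).
have [_ memL] := power_subgroup genm (Hgrp_torsion hP _) Lgrp.
have [_ memM] := power_subgroup genn (Hgrp_torsion hP _) Mgrp.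
exists (Sub x xP); split=> [i y|y].
  rewrite SubK => yx.
  by rewrite /preim_tilde /= /pi_tilde yx !clsX // memL memM.
have [i yi] := gen _ (leqnn _) (cls (maxn m n) (val y)); exists i.
rewrite -clsX // in yi.
have yL := cls_leq finRP (leq_maxl _ _) (valP y) (prime_idealrX i xP) yi.
have yM := cls_leq finRP (leq_maxr _ _) (valP y) (prime_idealrX i xP) yi.
by rewrite /preim_tilde /= /pi_tilde yL yM !clsX // memL memM.
Qed.

(** If X is contained in Y, then the element of coordinate d is in X, hence in
    Y. *)
Lemma preim_of_index_sub X Y d e : preim_of_index X d -> preim_of_index Y e ->
  (X `<=` Y <-> (e %| d)%N).
Proof.
move=> Xd Ye; have [x [xX yX]] := preim_of_index_coords Xd Ye.
split=> [XY|ed y Xy]; last first.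
  have [i [Xi Yi]] := yX y.
  by apply/Yi; apply: dvdn_trans ed _; apply/Xi.
have xdP : val x ^+ d \notin P by rewrite prime_idealrX ?(valP x).
have [Xi Yi] := xX d (Sub (val x ^+ d) xdP) (SubK _ _).
by apply/Yi/XY/Xi.
Qed.

Lemma preim_of_index_index X d e : preim_of_index X d -> preim_of_index X e -> d = e.
Proof.
by move=> Xd Xe; apply/eqP; rewrite eqn_dvd; apply/andP; split;
  [apply/(preim_of_index_sub Xe Xd) | apply/(preim_of_index_sub Xd Xe)].
Qed.

Lemma ThetaE X d : preim_of_index X d -> Theta P X = d.
Proof.
move=> Xd; rewrite /Theta; case: xgetP => [e _ Xe|/(_ d)//].
exact: preim_of_index_index Xe Xd.
Qed.

Lemma preim_of_index_calD X d : preim_of_index X d -> calD P d.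
Proof.
move=> [n [L [Lgrp _ ->]]]; exists n.
have [x xP /(_ n (leqnn n)) gen] := Hgrp_generator hP n.
have [_ memL] := power_subgroup gen (Hgrp_torsion hP _) Lgrp.
by rewrite -memL Hgrp_expg_card //; case: Lgrp.
Qed.

(** * Closures of the sets of powers *)

Lemma closure_powP (q y : outside P) : closure (pow_set q) y <->
  forall n, exists t, cls n (val y) = (cls n (val q) ^+ t)%g.
Proof.
rewrite closure_outsideP; split=> H n; have := H n.
  move=> [z [u [t [uU _ zE]]] zy]; exists t.
  rewrite -clsX ?(valP q) //; apply/cls_eqP;
    rewrite ?prime_idealrX ?(valP q) ?(valP y) //.
  by exists u; rewrite // -zE -opprB rpredN.
(* pow(q) only has positive exponents, so the order of the group is added *)
move=> [t yt]; pose s := (t + group_card (Hgrp P n))%N.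
have /cls_eqP[||//|u uU yu] : cls n (val y) = cls n (val q ^+ s).
- by rewrite clsX ?(valP q) // expgnDr Hgrp_expg_card // mulg1.
- exact: finRP.
- exact: valP y.
- by rewrite prime_idealrX ?(valP q).
have uqP : u * val q ^+ s \notin P.
  by rewrite prime_idealrM negb_or prime_idealrX ?(valP q) // unit_notin_prime.
exists (Sub (u * val q ^+ s) uqP); last by rewrite SubK -opprB rpredN.
by exists u, s; rewrite SubK addn_gt0 card_Hgrp_gt0 ?orbT.
Qed.

(** In terms of a generator of H_N with N > n, q and y have exponents j and i, and
    y is a power of q at level n, resp. N, when the gcd of j with the order at
    this level divides i.  By [gcdn_stable] the second gcd divides the first. *)
Lemma closure_pow_stable p m n (q : outside P) : prime p ->
  (forall k, exists a, group_card (Hgrp P k) = (m * p ^ a)%N) ->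
  (cls n (val q) ^+ m)%g != 1%g ->
  closure (pow_set q) = preim_tilde (powers (pi_tilde n q)).
Proof.
move=> p_pr shape qm; rewrite eqEsubset; split=> y.
  by move=> /closure_powP/(_ n) yq; apply/powersP.
move=> /powersP yq; apply/closure_powP => N.
have [Nn|nN] := leqP N n.
  have [t yt] := yq; exists t; move: yt; rewrite /pi_tilde -!clsX ?(valP q) //.
  by apply: cls_leq; rewrite ?prime_idealrX ?(valP q) ?(valP y).
have [x xP gen] := Hgrp_generator hP N.
have genN := gen N (leqnn N); have genn := gen n (ltnW nN).
have [j qj] := genN (cls N (val q)); have [i yi] := genN (cls N (val y)).
rewrite yi qj; apply/powersP.
rewrite (mem_powers genN (Hgrp_torsion hP _)).
have [[a Ma] [b Mb]] := (shape n, shape N).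
have down z k : z \notin P -> cls N z = (cls N x ^+ k)%g -> cls n z = (cls n x ^+ k)%g.
  by move=> zP; rewrite -!clsX //; apply: cls_leq; rewrite ?prime_idealrX // ltnW.
have qjn := down _ _ (valP q) qj; have yin := down _ _ (valP y) yi.
have gM : (gcdn j (group_card (Hgrp P N)) %| group_card (Hgrp P n))%N.
  rewrite Ma Mb; apply: gcdn_stable => //; rewrite -Ma.
  by rewrite -(Hgrp_expgE hP xP genn) expgnA -qjn.
apply: (@dvdn_trans (gcdn j (group_card (Hgrp P n)))).
  by rewrite dvdn_gcd dvdn_gcdl.
rewrite -(mem_powers genn (Hgrp_torsion hP _)).
by apply/powersP; rewrite -qjn -yin.
Qed.

Hypothesis hU : closed (units_outside P).

(** An element with trivial classes at all levels is a limit of units. *)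
Lemma nonunit_cls (x : R) : x \notin P -> x \isn't a GRing.unit ->
  exists n, cls n x != 1%g.
Proof.
move=> xP xU; apply: contrapT => nex; move/negP: xU; apply.
suff : units_outside P (Sub x xP) by [].
apply: hU; apply/closure_outsideP => n.
have /cls_eq1P[//|//|u uU xu] : cls n x = 1%g.
  by apply/eqP; apply: contrapT => /negP ne; apply: nex; exists n.
have uP := unit_notin_prime P uU.
by exists (Sub u uP); rewrite /units_outside /= ?SubK // -opprB rpredN.
Qed.

Lemma calX_preim_of_index X : calX P X -> exists d, preim_of_index X d.
Proof.
move=> [q [[_ qU _] _] <-].
have [p [m [p_pr m0 shape]]] := card_Hgrp_shape hP.
have qmU : val q ^+ m \isn't a GRing.unit by rewrite unitrX_pos.
have [n] := nonunit_cls (prime_idealrX m (valP q)) qmU.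
rewrite clsX ?(valP q) // => qm.
exists (group_index (powers (pi_tilde n q))), n, (powers (pi_tilde n q)).
split=> //; last exact: (closure_pow_stable p_pr shape qm).
have [x xP /(_ n (leqnn n)) gen] := Hgrp_generator hP n.
exact: powers_closed gen (Hgrp_torsion hP _) _.
Qed.

(** The exponent d of x yields index d at level N whenever d divides the order at
    this level; the choice of N makes this index stable. *)
Lemma dirichlet_preim_of_index d : dirichlet P -> calD P d ->
  exists2 X, calX P X & preim_of_index X d.
Proof.
move=> dir [n dM]; have [p [m [p_pr m0 shape]]] := card_Hgrp_shape hP.
have dir' N x : x \notin P -> exists q : outside P,
    almost_prime (val q) /\ cls N (val q) = cls N x.
  move=> xP; have [q [qap qx]] := dir (Sub x xP) N; rewrite SubK in qx.
  have qP : q \notin P.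
    apply: contra xP => qP; rewrite -(subrKC q x) rpredD // -opprB rpredN.
    exact: idealX_sub qx.
  by exists (Sub q qP); rewrite SubK; split=> //; apply: cls_near.
(* a nonunit outside P has a power that is trivial at level n but not at N *)
have [N nN ltM] : exists2 N, (n <= N)%N &
    ~~ (group_card (Hgrp P N) %| group_card (Hgrp P n) * m)%N.
  have [q0 [[[_ q0U _] _] _]] := dir' 0%N 1 (negbT (idealr1 P)).
  have q0P := prime_idealrX (group_card (Hgrp P n) * m) (valP q0).
  have [|k qk] := nonunit_cls q0P.
    by rewrite unitrX_pos // muln_gt0 card_Hgrp_gt0.
  exists (maxn n k); first exact: leq_maxl.
  apply: contra qk => /dvdnP[c cE]; apply/eqP.
  rewrite -(cls1 finRP); apply: (cls_leq finRP (leq_maxr n k)); rewrite ?idealr1 //.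
  by rewrite cE mulnC clsX ?(valP q0) // expgnA Hgrp_expg_card // expg1n cls1.
have [x xP /(_ N (leqnn N)) gen] := Hgrp_generator hP N.
have [q [qap qx]] := dir' N _ (prime_idealrX d xP).
rewrite clsX // in qx.
have qm : (cls N (val q) ^+ m)%g != 1%g.
  rewrite qx -expgnA Hgrp_expgE //; apply: contra ltM => MN.
  by apply: dvdn_trans MN _; rewrite dvdn_mul.
exists (closure (pow_set q)); first by exists q.
exists N, (powers (pi_tilde N q)); split.
- exact: powers_closed gen (Hgrp_torsion hP _) _.
- exact: (closure_pow_stable p_pr shape qm).
- rewrite /pi_tilde qx powers_index //; last exact: Hgrp_torsion.
  by apply/esym/gcdn_idPl; apply: dvdn_trans dM _; apply: card_Hgrp_dvd.
Qed.

End Preimages.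

Theorem theorem5p12 (R : idomainType) (P : prime_idealr R)
  (hR : dedekind R) (hCl : torsion_class_group R)
  (hP0 : exists2 x : R, x \in P & x != 0%R)
  (hP : almost_cyclic P) (hU : closed (units_outside P)) :
  (* (a): Theta is well defined, *)
  [/\ forall X, calX P X -> exists (n : nat) (L : {pred Hgrp P n}),
        group_closed L /\ X = preim_tilde L,
      forall X, calX P X ->
        forall (m n : nat) (L : {pred Hgrp P m}) (M : {pred Hgrp P n}),
        group_closed L -> group_closed M ->
        X = preim_tilde L -> X = preim_tilde M ->
        group_index L = group_index M,
      set_fun (calX P) (calD P) (Theta P),
  (* injective and order-reversing; *)
      set_inj (calX P) (Theta P)
    & forall X Y, calX P X -> calX P Y -> X `<=` Y ->
        (Theta P Y %| Theta P X)%N]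
  /\
  (* (b) *)
  (dirichlet P ->
    [/\ set_surj (calX P) (calD P) (Theta P),
        set_bij (calX P) (calD P) (Theta P)
      & forall X Y, calX P X -> calX P Y ->
          (X `<=` Y <-> (Theta P Y %| Theta P X)%N)]).
Proof.
have lvl := calX_preim_of_index hP hU.
have inX X : calX P X -> preim_of_index X (Theta P X).
  by move=> /lvl[d Xd]; rewrite (ThetaE hP Xd).
have subE X Y : calX P X -> calX P Y ->
    (X `<=` Y <-> (Theta P Y %| Theta P X)%N).
  by move=> /inX Xd /inX Ye; apply: preim_of_index_sub Xd Ye.
have Tfun : set_fun (calX P) (calD P) (Theta P).
  by move=> X /inX; apply: preim_of_index_calD.
have Tinj : set_inj (calX P) (Theta P).
  move=> X Y /set_mem XX /set_mem YX e; rewrite eqEsubset.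
  by split; apply/subE => //; rewrite e.
split.
  split=> //.
  - by move=> X /lvl[_ [n [L [Lgrp XL _]]]]; exists n, L.
  - move=> X _ m n L M Lgrp Mgrp XL XM.
    by apply: (preim_of_index_index hP (X := X)); [exists m, L | exists n, M].
  - by move=> X Y XX YX /subE; apply.
move=> dir.
have Tsurj : set_surj (calX P) (calD P) (Theta P).
  move=> d /(dirichlet_preim_of_index hP hU dir)[X XX Xd].
  by exists X => //; apply: ThetaE.
by split.
Qed.
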